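(* Let $\mathbb F$ be a finite field, $N\in\mathbb N$ and $i_1,\dots,i_N\ge0$ with $i_1+\dots+i_N=1$. Then $\dim\mathrm{Bad}_{\mathbb F((X^{-1}))}(i_1,\dots,i_N)=N$.
   Context: Let $\mathbb F$ have $h$ elements. $\mathbb F((X^{-1}))=\{\sum_{i=-n}^{\infty}a_{-i}X^{-i}: n\in\mathbb Z, a_i\in\mathbb F, a_n\ne0\}\cup\{0\}$ (formal Laurent series in $X^{-1}$), with absolute value $\|\sum_{i=-n}^\infty a_{-i}X^{-i}\|=h^n$ (for $a_n\neq0$) and $\|0\|=0$; $\mathbb F((X^{-1}))^N$ carries the metric $d(x,y)=\max_s\|x_s-y_s\|$ and $\dim$ is Hausdorff dimension with respect to it. $\mathbb F[X]$ is the polynomial ring. $\mathrm{Bad}_{\mathbb F((X^{-1}))}(i_1,\dots,i_N)$ is the set of $x=(x_1,\dots,x_N)\in\mathbb F((X^{-1}))^N$ for which there is $c(x)>0$ such that $\max\{\|qx_1-p_1\|^{1/i_1},\dots,\|qx_N-p_N\|^{1/i_N}\}\ge c(x)\|q\|^{-1}$ for all $q,p_1,\dots,p_N\in\mathbb F[X]$ with $q\ne0$, where terms with $i_s=0$ are omitted from the maximum. *)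

(* Defs.v *)
From HB Require Import structures.
From mathcomp Require Import all_boot all_order all_algebra all_field.
From mathcomp Require Import all_classical all_reals all_analysis.
Set Implicit Arguments. Unset Strict Implicit. Unset Printing Implicit Defensive.
Import Order.TTheory GRing.Theory Num.Theory.
Local Open Scope classical_set_scope.
Local Open Scope ring_scope.

Section Hausdorff.
Variables (R : realType) (T : Type) (d : T -> T -> R).

(* diameter, in the extended reals (sup of empty set is -oo) *)
Definition diam (U : set T) : \bar R :=
  ereal_sup [set (d x y)%:E | x in U & y in U].

Definition cover_term (s : R) (U : set T) : R :=
  if pselect (U = set0) then 0 else (fine (diam U)) `^ s.

Definition hausdorff_content (s delta : R) (A : set T) : \bar R :=
  ereal_inf [set (\sum_(0 <= n <oo) (cover_term s (U n))%:E)%E |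
             U in [set U : nat -> set T |
                   A `<=` \bigcup_n U n /\ forall n, (diam (U n) <= delta%:E)%E]].

(* H^s(A) = lim_{delta -> 0+} H^s_delta(A) = sup_{delta > 0} H^s_delta(A) *)
Definition hausdorff_measure (s : R) (A : set T) : \bar R :=
  ereal_sup [set hausdorff_content s delta A | delta in [set delta : R | 0 < delta]].

Definition hausdorff_dim (A : set T) : \bar R :=
  ereal_inf [set s%:E | s in [set s : R | 0 <= s /\ hausdorff_measure s A = 0%E]].
End Hausdorff.

Section Laurent.
Variables (R : realType) (F : finFieldType).

(* a formal Laurent series in X^{-1}, given by its coefficients:
   f k = coefficient of X^k, with f k = 0 for all large k *)
Definition is_laurent (f : int -> F) : Prop :=
  exists n : int, forall k : int, n < k -> f k = 0.

Definition laurent := {f : int -> F | is_laurent f}.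

(* ||f|| = h^n where n is the largest k with f k <> 0; ||0|| = 0 *)
Definition lnorm (f : int -> F) : R :=
  sup [set ((#|F|%:R : R) ^ k) | k in [set k : int | f k != 0]].

Definition poly_coef (p : {poly F}) (k : int) : F :=
  match k with Posz n => p`_n | Negz _ => 0 end.

Definition pmul_coef (q : {poly F}) (x : int -> F) (k : int) : F :=
  \sum_(j < size q) q`_j * x (k - (j : nat)%:Z).

Definition approx_err (q p : {poly F}) (x : laurent) : R :=
  lnorm (fun k => pmul_coef q (sval x) k - poly_coef p k).

Definition pnorm (q : {poly F}) : R := lnorm (poly_coef q).

Definition laurent_dist (N : nat) (x y : 'I_N -> laurent) : R :=
  \big[Num.max/0]_(s < N) lnorm (fun k => sval (x s) k - sval (y s) k).

Definition Bad (N : nat) (i : 'I_N -> R) : set ('I_N -> laurent) :=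
  [set x | exists2 c : R, 0 < c &
     forall (q : {poly F}) (p : 'I_N -> {poly F}), q != 0 ->
       \big[Num.max/0]_(s < N | i s != 0) (approx_err q (p s) (x s)) `^ (i s)^-1
         >= c * (pnorm q)^-1].
End Laurent.

(* Main.v *)
(** Upper bound: a ball of radius [h ^ M] in F((1/X))^N splits into [h ^ (N (M + n))]
    balls of radius [h ^ - n], so the [s]-dimensional measure of the whole space is 0
    for [s > N].

    Lower bound: write [x s k] for the coefficient of X^-(k+1) in x_s. At stage [n] the
    digits [x s k] with [k < n T + e_n(s)] are known, where
    [e_n(s) = floor ((n T + C) i_s)], and they are chosen so that for no nonzero [q] with
    [deg q < n T] the coefficients of X^-1, ..., X^-e_n(s) in q x_s vanish for all [s]
    with [i_s <> 0]. Counting dimensions, the known digits admit polynomials [a_s], not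
    all zero, of degree less than [e_n(s) - T], such that the first [n T + T] digits of
    L = sum_s a_s x_s vanish (the simplex lemma: all dangerous rational points lie on one
    rational hyperplane). If some [q] violates the requirement of stage [n + 1], then the
    identity between q L and sum_s a_s (q x_s) propagates the vanishing to [tau] further
    digits of [L], each of which determines a new digit of x_s for one fixed [s]. Hence
    at most a proportion [h ^ - tau] of the extensions is bad.

    To escape a given cover [U_j] as well, no measure is constructed: a weighted sum of
    the densities of the [U_j] relative to the known digits is a martingale, so some good
    extension increases it by a factor at most [(1 - h ^ - tau)^-1], which is too slow
    for the limit point to fall into any [U_j]. *)
Require Import Defs.
From HB Require Import structures.
From mathcomp Require Import all_boot all_order all_algebra all_field.
From mathcomp Require Import all_classical all_reals all_analysis.
From mathcomp Require Import zify ring lra.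
Set Implicit Arguments. Unset Strict Implicit. Unset Printing Implicit Defensive.
Import Order.TTheory GRing.Theory Num.Theory.
Local Open Scope classical_set_scope.
Local Open Scope ring_scope.

(** * Digits, linear forms and dangerous extensions *)

Section Digits.
Variable F : finFieldType.

(* With [x k] the coefficient of X^-(k+1) in a fractional series, this is the coefficient
   of X^-(j+1) in its product with [p]. *)
Definition frac_coef (p : {poly F}) (x : nat -> F) (j : nat) : F :=
  \sum_(l < size p) p`_l * x (j + l)%N.

Lemma frac_coef_widen m (p : {poly F}) x j : (size p <= m)%N ->
  frac_coef p x j = \sum_(l < m) p`_l * x (j + l)%N.
Proof.
move=> pm; rewrite /frac_coef (big_ord_widen m (fun l => p`_l * x (j + l)%N) pm).
rewrite [RHS](bigID (fun l : 'I_m => (l < size p)%N)) /= [X in _ + X]big1 ?addr0//.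
by move=> l; rewrite -leqNgt => /leq_sizeP/(_ l (leqnn _)) ->; rewrite mul0r.
Qed.

Lemma eq_frac_coef (p : {poly F}) x y j :
  (forall k, (j <= k < j + size p)%N -> x k = y k) -> frac_coef p x j = frac_coef p y j.
Proof. by move=> xy; apply: eq_bigr => l _; rewrite xy// leq_addr ltn_add2l ltn_ord. Qed.

(** Both sides are the coefficient of X^-(j+1) in p q x. *)
Lemma frac_coef_exchange (p q : {poly F}) x j :
  \sum_(i < size p) p`_i * frac_coef q x (j + i)%N =
  \sum_(l < size q) q`_l * frac_coef p x (j + l)%N.
Proof.
under eq_bigr do rewrite big_distrr /=.
rewrite exchange_big; apply: eq_bigr => l _; rewrite big_distrr /=.
by apply: eq_bigr => i _; rewrite mulrCA addnAC.
Qed.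

(** Vanishing coefficients of q L amount to a linear recurrence of order deg q for [L]; the leading
    coefficient of [q] is invertible, so zero initial values propagate. *)
Lemma linear_recurrence0 (q : {poly F}) (L : nat -> F) J : q != 0 ->
  (forall j, (j < (size q).-1)%N -> L j = 0) ->
  (forall j, (j < J)%N -> frac_coef q L j = 0) ->
  forall j, (j < J + (size q).-1)%N -> L j = 0.
Proof.
move=> q0 Linit Lrec; elim/ltn_ind => j IH jJ.
have [/Linit//|dj] := ltnP j (size q).-1.
have sq : size q = (size q).-1.+1 by rewrite prednK// size_poly_gt0.
have := Lrec (j - (size q).-1)%N; rewrite /frac_coef sq big_ord_recr /=.
rewrite big1 ?add0r => [|l _]; last first.
  by rewrite IH ?mulr0//; have /= := ltn_ord l; clear sq; set d := (size q).-1; lia.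
rewrite subnK// => /(_ _)/eqP; rewrite mulf_eq0 -lead_coefE lead_coef_eq0 (negPf q0).
by move=> h; apply/eqP/h; move: jJ dj; clear; set d := (size q).-1; lia.
Qed.

Variable N : nat.
Implicit Types (a : 'I_N -> {poly F}) (x y z : 'I_N -> nat -> F).

Definition form_coef a x j : F := \sum_s frac_coef (a s) (x s) j.

(** The identity q L = sum_s a_s (q x_s) for L = sum_s a_s x_s. *)
Lemma form_coef_exchange a x q j :
  frac_coef q (form_coef a x) j = \sum_s \sum_(i < size (a s)) (a s)`_i * frac_coef q (x s) (j + i)%N.
Proof.
rewrite /frac_coef /form_coef; under eq_bigr do rewrite big_distrr /=.
by rewrite exchange_big; apply: eq_bigr => s _; rewrite frac_coef_exchange.
Qed.

(* More unknown coefficients than linear conditions. *)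
Lemma exists_annihilating_form (g : 'I_N -> nat) M x : (M < \sum_s g s)%N ->
  exists a, [/\ exists s, a s != 0, forall s, (size (a s) <= g s)%N &
    forall j, (j < M)%N -> form_coef a x j = 0].
Proof.
move=> Mg.
pose I : finType := {s : 'I_N & 'I_(g s)}.
have cI : #|I| = (\sum_s g s)%N.
  rewrite card_tagged sumnE big_map big_enum /=.
  by apply: eq_bigr => s _; rewrite card_ord.
(* Rows are the unknown coefficients (s, i), columns the conditions [j]; a nonzero row vector in the
   kernel is an annihilating form. *)
pose A := \matrix_(k < #|I|, j < M)
  x (tag (enum_val k)) (j + tagged (enum_val k))%N.
have kA : kermx A != 0.
  rewrite kermx_eq0 /row_free; apply: contraL Mg => /eqP eA.
  by rewrite -leqNgt -cI -eA rank_leq_col.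
pose v := nz_row (kermx A).
have vA : v *m A = 0 by apply/sub_kermxP; exact: nz_row_sub.
have v0 : v != 0 by rewrite nz_row_eq0.
pose c (t : I) := v 0 (enum_rank t).
pose a s := \poly_(i < g s) oapp (fun o : 'I_(g s) => c (Tagged _ o)) 0 (insub i).
have aE s (i : 'I_(g s)) : (a s)`_i = c (Tagged _ i).
  by rewrite coef_poly ltn_ord valK.
exists a; split.
- case: (pickP (fun k => v 0 k != 0)) => [k vk|v00]; last first.
    suff /eqP : v = 0 by rewrite (negPf v0).
    apply/rowP => k; rewrite mxE; apply/eqP.
    by rewrite -[_ == _]negbK v00.
  exists (tag (enum_val k)); apply: contraNneq vk => as0.
  have := aE _ (tagged (enum_val k)); rewrite as0 coef0 /c.
  have -> : Tagged (fun s => 'I_(g s)) (tagged (enum_val k)) = enum_val k :> I.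
    by case: (enum_val k).
  by rewrite enum_valK => <-.
- by move=> s; exact: size_poly.
- move=> j jM; rewrite /form_coef.
  under eq_bigr => s _ do rewrite (frac_coef_widen _ _ (size_poly (g s) _)).
  under eq_bigr => s _ do under eq_bigr => i _ do rewrite -/(a s) aE.
  rewrite (sig_big_dep _ _ (fun s (i : 'I_(g s)) => c (Tagged _ i) * x s (j + i)%N)) /=.
  have /rowP/(_ (Ordinal jM)) := vA; rewrite !mxE => {2}<-.
  rewrite (reindex (fun k : 'I_#|I| => enum_val k)) /=; last first.
    by apply: onW_bij; exact: enum_val_bij.
  apply: eq_bigr => k _; rewrite mxE; congr (_ * _).
  have -> : Tagged (fun s => 'I_(g s)) (tagged (enum_val k)) = enum_val k :> I.
    by case: (enum_val k).
  by rewrite /c enum_valK.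
Qed.

(** The system is triangular: coefficient [j0 + r] of the form involves digits of [z s0] only up to
    [d + r], and that one is multiplied by the leading coefficient of [a s0]. *)
Lemma form_determines a s0 j0 d tau z z' :
  a s0 != 0 -> (j0 + (size (a s0)).-1 = d)%N ->
  (forall s k, ~~ [&& s == s0, (d <= k)%N & (k < d + tau)%N] -> z s k = z' s k) ->
  (forall r, (r < tau)%N -> form_coef a z (j0 + r)%N = form_coef a z' (j0 + r)%N) ->
  forall r, (r < tau)%N -> z s0 (d + r)%N = z' s0 (d + r)%N.
Proof.
move=> as0 jd zz' fz; elim/ltn_ind => r IH rtau.
have := fz _ rtau; rewrite /form_coef (bigD1 s0)//= [in RHS](bigD1 s0)//=.
have -> : \sum_(s | s != s0) frac_coef (a s) (z s) (j0 + r)%N =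
          \sum_(s | s != s0) frac_coef (a s) (z' s) (j0 + r)%N.
  apply: eq_bigr => s ss0; apply: eq_frac_coef => k _; apply: zz'.
  by rewrite (negPf ss0).
move/addIr; have sa : size (a s0) = (size (a s0)).-1.+1.
  by rewrite prednK// size_poly_gt0.
rewrite /frac_coef sa !big_ord_recr /=.
have -> : \sum_(i < (size (a s0)).-1) (a s0)`_i * z s0 (j0 + r + i)%N =
          \sum_(i < (size (a s0)).-1) (a s0)`_i * z' s0 (j0 + r + i)%N.
  apply: eq_bigr => i _; congr (_ * _); have il := ltn_ord i.
  have [lt|ge] := ltnP (j0 + r + i) d; first by apply: zz'; lia.
  have -> : (j0 + r + i = d + (j0 + r + i - d))%N by lia.
  by apply: IH; lia.
move/addrI/(mulfI _); rewrite -lead_coefE lead_coef_eq0 as0 => /(_ isT).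
by have -> : (j0 + r + (size (a s0)).-1 = d + r)%N by lia.
Qed.

(* Injectivity of the map sending [q] of degree less than [K] to the coefficients of
   X^-1, ..., X^-(e s) in q x_s, for [s] in [P]. *)
Definition inj_level (P : pred 'I_N) (e : 'I_N -> nat) (K : nat) x : Prop :=
  forall q : {poly F}, q != 0 -> (size q <= K)%N ->
    exists s j, [/\ P s, (j < e s)%N & frac_coef q (x s) j != 0].

(* [s0] minimizes [e s - deg (a s)]: then the [tau] extra digits of the form only involve
   digits of [y s] below [K + e s + tau], and reach exactly that far for [s = s0]. *)
Lemma dangerous_form (P : pred 'I_N) (e e' : 'I_N -> nat) K T tau x :
  (forall s, P s -> e s + tau <= e' s)%N ->
  (K + T < \sum_(s | P s) (e s - T))%N ->
  inj_level P e K x ->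
  exists a s0 j0, [/\ P s0, a s0 != 0, (j0 + (size (a s0)).-1 = K + e s0)%N &
   forall y (q : {poly F}), (forall s k, (k < K + e s)%N -> y s k = x s k) ->
     q != 0 -> (size q <= K + T)%N ->
     (forall s j, P s -> (j < e' s)%N -> frac_coef q (y s) j = 0) ->
     forall r, (r < tau)%N -> form_coef a y (j0 + r)%N = 0].
Proof.
move=> ee' KTe xK.
rewrite big_mkcond /= in KTe.
have [a [[s1 as1] asz aL]] := exists_annihilating_form x KTe.
have aP s : a s != 0 -> P s.
  by have := asz s; case: (P s) => //; rewrite leqn0 size_poly_eq0 => ->.
have aszP s : P s -> (size (a s) <= e s - T)%N by move=> Ps; have := asz s; rewrite Ps.
have [s0 as0 s0min] := @arg_minnP _ s1 (fun s => a s != 0)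
   (fun s => e s - (size (a s)).-1)%N as1.
exists a, s0, (K + e s0 - (size (a s0)).-1)%N; split => //; first exact: aP.
  by rewrite subnK//; have := aszP _ (aP _ as0); lia.
move=> y q yx q0 qKT qy r rtau.
(* [inj_level] excludes smaller [q]; deg q >= K makes the recurrence below reach [j0 + tau]. *)
have Kq : (K < size q)%N.
  rewrite ltnNge; apply/negP => qK.
  have [s [j [Ps je]]] := xK q q0 qK; case/eqP.
  rewrite -(qy s j Ps); last by have := ee' s Ps; lia.
  by apply: eq_frac_coef => k kj; rewrite yx//; lia.
apply: (@linear_recurrence0 q _ (e s0 - (size (a s0)).-1 + tau) q0); last first.
- by have := aszP _ (aP _ as0); lia.
- move=> j jJ; rewrite form_coef_exchange big1// => s _; rewrite big1// => i _.
  have [as00|as0'] := eqVneq (a s) 0; first by case: i => i ? /=; rewrite as00 coef0 mul0r.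
  rewrite qy ?mulr0//; first exact: aP.
  have := ee' s (aP _ as0'); have := s0min s as0'; have := ltn_ord i.
  by have := aszP s (aP _ as0'); lia.
(* As deg q < K + T and [a s] has at most [e s - T] coefficients, only digits below [K + e s] enter,
   where [y] agrees with [x]. *)
- move=> j jq; rewrite -(aL j); last by lia.
  apply: eq_bigr => s _; apply: eq_frac_coef => k kj; apply: yx.
  by have := asz s; case: ifP => _; lia.
Qed.

(** Entries of [y] below [D] are ignored, so that proportions are counted over one rectangular type
    of tables. *)
Definition splice L (D : 'I_N -> nat) x (y : {ffun 'I_N * 'I_L -> F}) : 'I_N -> nat -> F :=
  fun s k => if (k < D s)%N then x s k else oapp (fun o => y (s, o)) 0 (insub k).

Lemma splice_lt L D x (y : {ffun 'I_N * 'I_L -> F}) s k :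
  (k < D s)%N -> splice D x y s k = x s k.
Proof. by rewrite /splice => ->. Qed.

Lemma splice_ge L D x (y : {ffun 'I_N * 'I_L -> F}) s (k : 'I_L) :
  (D s <= k)%N -> splice D x y s k = y (s, k).
Proof. by rewrite /splice ltnNge => ->; rewrite valK. Qed.

(* Shifting the [tau] digits of [x s0] from position [D s0] on by arbitrary elements of [F]
   is injective on the set of vanishing splices, because these digits are determined. *)
Lemma card_form_vanish L D x a s0 j0 tau :
  a s0 != 0 -> (j0 + (size (a s0)).-1 = D s0)%N -> (D s0 + tau <= L)%N ->
  (#|[set y : {ffun 'I_N * 'I_L -> F} |
      [forall r : 'I_tau, form_coef a (splice D x y) (j0 + r)%N == 0%R]]%SET| * #|F| ^ tau
   <= #|{ffun 'I_N * 'I_L -> F}|)%N.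
Proof.
move=> as0 jd DL; set B := [set y | _]%SET.
have -> : (#|F| ^ tau = #|{: {ffun 'I_tau -> F}}|)%N by rewrite card_ffun card_ord.
rewrite -cardsT -cardsX.
pose shift (yw : {ffun 'I_N * 'I_L -> F} * {ffun 'I_tau -> F}) :=
  [ffun p : 'I_N * 'I_L => yw.1 p + (if (p.1 == s0) && (D s0 <= p.2)%N
     then oapp yw.2 0 (insub (p.2 - D s0)%N) else 0)].
have shift_inj : {in finset.setX B [set: {ffun 'I_tau -> F}]%SET &, injective shift}.
  move=> [y w] [y' w']; rewrite !inE !andbT /= => /forallP yB /forallP y'B /ffunP yw.
  (* Outside the window the shift adds 0; inside it, both forms vanish and [form_determines]
     applies. *)
  have yy' s k : ~~ [&& s == s0, (D s0 <= k)%N & (k < D s0 + tau)%N] ->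
      splice D x y s k = splice D x y' s k.
    rewrite /splice; case: ifP => // kD np; case: insubP => //= o _ ok.
    have := yw (s, o); rewrite !ffunE /= ok; case: ifP np => [/andP[-> ->]/=|_ _].
      by move=> kt; rewrite !insubN ?addr0//; lia.
    by rewrite !addr0.
  have eqr : forall r, (r < tau)%N -> form_coef a (splice D x y) (j0 + r)%N =
       form_coef a (splice D x y') (j0 + r)%N.
    by move=> r rt; rewrite (eqP (yB (Ordinal rt))) (eqP (y'B (Ordinal rt))).
  have zz := form_determines as0 jd yy' eqr.
  have yE : y = y'.
    apply/ffunP => -[s k]; have [kD|Dk] := ltnP k (D s).
      have := yw (s, k); rewrite !ffunE /=; case: ifP => [/andP[/eqP <-]|]; first by lia.
      by rewrite !addr0.
    rewrite -!(splice_ge x _ Dk).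
    have [/and3P[/eqP -> Dk0 kt]|/yy'//] :=
      boolP [&& s == s0, (D s0 <= k)%N & (k < D s0 + tau)%N].
    by rewrite -(subnKC Dk0); apply: zz; lia.
  congr pair => //; apply/ffunP => r.
  have rL : (D s0 + r < L)%N by have := ltn_ord r; lia.
  have := yw (s0, Ordinal rL); rewrite !ffunE /= eqxx leq_addr /= addKn valK /= yE.
  exact: addrI.
rewrite -(card_in_imset shift_inj); exact: max_card.
Qed.

End Digits.

(** * The potential of a cover *)

Section Potential.
Variables (R : realType) (F : finFieldType) (N : nat).
Implicit Types (x u : 'I_N -> nat -> F) (D : 'I_N -> nat).
Local Notation h := (#|F|%:R : R).

Lemma natr_card_gt1 : 1 < h.
Proof. by rewrite ltr1n finNzRing_gt1. Qed.

Lemma natr_card_gt0 : 0 < h.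
Proof. exact: lt_trans ltr01 natr_card_gt1. Qed.

(* The density, relative to the uniform measure on the digits below [D], of the digits of
   a uniformly random point that agrees with [u] on the first [m] digits. *)
Definition density m u D x : R :=
  \prod_s \prod_(k < D s) (if (k < m)%N then h * (x s k == u s k)%:R else 1).

Lemma density_ge0 m u D x : 0 <= density m u D x.
Proof. by apply: prodr_ge0 => s _; apply: prodr_ge0 => k _; case: ifP. Qed.

Lemma density_le m u D x : density m u D x <= h ^+ (\sum_s D s).
Proof.
rewrite -prodrXr; apply: ler_prod => s _; apply/andP; split.
  by apply: prodr_ge0 => k _; case: ifP.
have -> : h ^+ D s = \prod_(k < D s) h by rewrite prodr_const card_ord.
apply: ler_prod => k _; have h1 := natr_card_gt1; case: ifP => _; last by rewrite ler01 ltW.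
by case: eqP => _; rewrite ?mulr1 ?mulr0 ?lexx ?(ltW natr_card_gt0).
Qed.

Lemma density_full m u D x : (forall s, (m <= D s)%N) ->
  (forall s k, (k < m)%N -> x s k = u s k) -> density m u D x = h ^+ (N * m).
Proof.
move=> mD xu; rewrite /density (eq_bigr (fun=> h ^+ m)) => [|s _].
  by rewrite prodr_const card_ord -exprM mulnC.
rewrite -(subnKC (mD s)) big_split_ord /= [X in _ * X]big1 ?mulr1 => [|k _].
  have -> : h ^+ m = \prod_(k < m) h by rewrite prodr_const card_ord.
  apply: eq_bigr => k _.
  by rewrite ltn_ord xu// eqxx mulr1.
by rewrite ltnNge leq_addr.
Qed.

(** Martingale property: the factors of the digits between [D] and [D'] are independent and have
    mean 1. *)
Lemma density_average L m u D D' x :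
  (forall s, (D s <= D' s)%N) -> (forall s, (D' s <= L)%N) ->
  \sum_(y : {ffun 'I_N * 'I_L -> F}) density m u D' (splice D x y) =
  #|{ffun 'I_N * 'I_L -> F}|%:R * density m u D x.
Proof.
move=> DD' D'L.
pose phi s (k : nat) (c : F) : R :=
  if (D s <= k < D' s)%N && (k < m)%N then h * (c == u s k)%:R else 1.
have splitE (y : {ffun 'I_N * 'I_L -> F}) : density m u D' (splice D x y) =
    density m u D x * \prod_(p : 'I_N * 'I_L) phi p.1 p.2 (y p).
  have -> : \prod_(p : 'I_N * 'I_L) phi p.1 p.2 (y p) =
      \prod_s \prod_(k < L) phi s k (y (s, k)).
    by rewrite pair_bigA /=; apply: eq_bigr => -[].
  rewrite -big_split /=; apply: eq_bigr => s _.
  have -> : \prod_(k < L) phi s k (y (s, k)) =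
      \prod_(k < L) phi s k (oapp (fun o => y (s, o)) 0 (insub (k : nat))).
    by apply: eq_bigr => k _; rewrite valK.
  pose f k := phi s k (oapp (fun o : 'I_L => y (s, o)) 0 (insub k)).
  rewrite -(big_mkord xpredT f).
  rewrite (big_cat_nat (leq0n _) (D'L s)) (big_cat_nat (leq0n _) (DD' s)) /=.
  have -> : \prod_(0 <= k < D s) f k = 1.
    by rewrite big_nat big1// => k k1; rewrite /f /phi ifF//; lia.
  have -> : \prod_(D' s <= k < L) f k = 1.
    by rewrite big_nat big1// => k k1; rewrite /f /phi ifF//; lia.
  rewrite mul1r mulr1.
  rewrite -(big_mkord xpredT (fun k => if (k < m)%N then
    h * (splice D x y s k == u s k)%:R else 1)).
  rewrite (big_cat_nat (leq0n _) (DD' s)) /=; congr (_ * _).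
    by rewrite big_mkord; apply: eq_bigr => k _; rewrite splice_lt.
  apply: eq_big_nat => k /andP[k1 k2].
  by rewrite /f /phi /splice k1 k2 /= [(k < D s)%N]ltnNge k1.
under eq_bigr do rewrite splitE.
rewrite -big_distrr /= mulrC; congr (_ * _).
rewrite -(bigA_distr_bigA (fun (p : 'I_N * 'I_L) c => phi p.1 p.2 c)) /=.
(* Each factor sums to h over [F]: either h ones, or a single match weighted by h. *)
rewrite (eq_bigr (fun=> h)) => [|p _].
  by rewrite prodr_const card_ffun natrX.
rewrite /phi; case: (_ && (p.2 < m)%N); last by rewrite sumr_const.
rewrite -big_distrr /= (bigD1 (u p.1 p.2))//= eqxx big1 ?addr0 ?mulr1//.
by move=> c /negPf ->.
Qed.

Variables (b : nat -> R) (m : nat -> nat) (u : nat -> 'I_N -> nat -> F).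
Hypothesis b0 : forall j, 0 <= b j.

Definition potential D x : \bar R :=
  (\sum_(0 <= j <oo) (b j * density (m j) (u j) D x)%:E)%E.

Lemma potential_term_ge0 D x j : (0 <= (b j * density (m j) (u j) D x)%:E)%E.
Proof. by rewrite lee_fin mulr_ge0// density_ge0. Qed.

Lemma potential_ge0 D x : (0 <= potential D x)%E.
Proof. by apply: nneseries_ge0 => j _ _; exact: potential_term_ge0. Qed.

Lemma potential_ge_term D x j :
  ((b j * density (m j) (u j) D x)%:E <= potential D x)%E.
Proof.
apply: le_trans (nneseries_lim_ge j.+1 _) => [|k _ _]; last exact: potential_term_ge0.
rewrite big_nat_recr//= leeDr// sume_ge0// => k _; exact: potential_term_ge0.
Qed.

Lemma potential_le D x :
  (potential D x <= (h ^+ (\sum_s D s))%:E * \sum_(0 <= j <oo) (b j)%:E)%E.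
Proof.
rewrite -nneseriesZl; last by move=> j _; rewrite lee_fin.
apply: lee_nneseries => j _ *; first exact: potential_term_ge0.
by rewrite -EFinM lee_fin mulrC ler_wpM2r// density_le.
Qed.

Lemma potential_average L D D' x :
  (forall s, (D s <= D' s)%N) -> (forall s, (D' s <= L)%N) ->
  (\sum_(y : {ffun 'I_N * 'I_L -> F}) potential D' (splice D x y) =
   #|{ffun 'I_N * 'I_L -> F}|%:R%:E * potential D x)%E.
Proof.
move=> DD' D'L; rewrite -nneseriesZl; last by move=> j _; exact: potential_term_ge0.
rewrite /potential -nneseries_sum; last by move=> *; exact: potential_term_ge0.
apply: eq_eseriesr => j _; rewrite sumEFin -EFinM; congr EFin.
by rewrite -big_distrr /= density_average// mulrCA.
Qed.

(** Tables outside [B] have proportion at least 1 - 1/H, so the least potential among them is at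
    most (1 - 1/H)^-1 times the overall mean, which is the potential of [x]. *)
Lemma exists_good_splice L D D' x H (B : {set {ffun 'I_N * 'I_L -> F}}) :
  (forall s, (D s <= D' s)%N) -> (forall s, (D' s <= L)%N) -> (1 < H)%N ->
  (#|B| * H <= #|{ffun 'I_N * 'I_L -> F}|)%N ->
  exists2 y, y \notin B &
    (potential D' (splice D x y) <= (1 - H%:R^-1)^-1%:E * potential D x)%E.
Proof.
move=> DD' D'L H1 BH; set G := #|{ffun _ -> _}| in BH.
have G0 : (0 < G)%N by apply/card_gt0P; exists [ffun=> 0].
have cB : #|~: B| = (G - #|B|)%N by rewrite /G -(cardsC B) addKn.
have [y0 y0B] : exists y0, y0 \in ~: B by apply/card_gt0P; rewrite cB; nia.
have [y yB ymin] := @Order.TotalTheory.arg_minP _ _ _ y0 (fun y => y \in ~: B)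
  (fun y => potential D' (splice D x y)) y0B.
exists y; first by move: yB; rewrite !inE.
have HR : (1 : R) < H%:R by rewrite ltr1n.
have c0 : 0 < 1 - H%:R^-1 :> R by rewrite subr_gt0 invf_lt1// (lt_trans ltr01).
have GR : 0 < G%:R :> R by rewrite ltr0n.
rewrite lee_pdivlMl//.
rewrite -(@lee_pmul2l _ G%:R%:E)//.
rewrite -(potential_average _ DD' D'L) muleA -EFinM.
apply: (@le_trans _ _ (\sum_(y | y \in ~: B) potential D' (splice D x y))%E); last first.
  rewrite [leRHS](bigID (fun y => y \in ~: B)) /= leeDl// sume_ge0// => z _.
  exact: potential_ge0.
apply: (@le_trans _ _ (\sum_(z | z \in ~: B) potential D' (splice D x y))%E); last first.
  by apply: lee_sum => z zB; exact: ymin.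
have -> : (\sum_(z | z \in ~: B) potential D' (splice D x y) =
    #|~: B|%:R%:E * potential D' (splice D x y))%E.
  rewrite -sum1_card natr_sum -sumEFin ge0_sume_distrl//.
  by apply: eq_bigr => z _; rewrite mul1e.
apply: lee_wpmul2r; first exact: potential_ge0.
rewrite lee_fin mulrBr mulr1 cB natrB; last by nia.
rewrite lerB// ler_pdivlMr// ?(lt_trans ltr01)// -natrM ler_nat.
exact: BH.
Qed.

(** Iterates [exists_good_splice]. If [x] matches [u j] on [m j] digits, its density at stage [m j]
    is h^(N m_j), whereas the potential starts below 1 and gains at most a factor [lambda] per
    stage. *)
Lemma avoiding_bad_digits (P : pred 'I_N) (e : nat -> 'I_N -> nat) T tau lambda :
  (0 < T)%N -> (0 < tau)%N ->
  (forall n s, e n s <= e n.+1 s)%N ->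
  (forall n s, P s -> e n s + tau <= e n.+1 s)%N ->
  (forall n, n * T + T < \sum_(s | P s) (e n s - T))%N ->
  (1 - (h ^+ tau)^-1)^-1 <= lambda ->
  (\sum_(0 <= j <oo) (b j)%:E < (h ^- (\sum_s e 0%N s))%:E)%E ->
  exists2 x, forall n, inj_level P (e n) (n * T) x &
    forall j, (forall s k, (k < m j)%N -> x s k = u j s k) ->
      b j * h ^+ (N * m j) < lambda ^+ m j.
Proof.
move=> T0 tau0 ee eetau eT lam bsum.
pose D n s := (n * T + e n s)%N.
have DD n s : (D n s <= D n.+1 s)%N by have := ee n s; rewrite /D; lia.
have htau : (1 : R) < h ^+ tau by rewrite exprn_egt1 ?natr_card_gt1// -lt0n.
have lam0 : 0 <= lambda.
  by apply: le_trans lam; rewrite invr_ge0 subr_ge0 invf_le1 ?(lt_trans ltr01)// ltW.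
(* The invariant is a premise, so that [choice] yields a total successor function. *)
have step (nx : nat * ('I_N -> nat -> F)) : exists y : 'I_N -> nat -> F,
    inj_level P (e nx.1) (nx.1 * T) nx.2 ->
    [/\ forall s k, (k < D nx.1 s)%N -> y s k = nx.2 s k,
      inj_level P (e nx.1.+1) (nx.1.+1 * T) y &
      (potential (D nx.1.+1) y <= lambda%:E * potential (D nx.1) nx.2)%E].
  case: nx => n x /=.
  have [xK|] := pselect (inj_level P (e n) (n * T) x); last by exists x.
  have [a [s0 [j0 [Ps0 as0 jd ann]]]] := dangerous_form (eetau n) (eT n) xK.
  pose L := (\max_s D n.+1 s)%N.
  have DL s : (D n.+1 s <= L)%N by exact: leq_bigmax.
  have tauL : (D n s0 + tau <= L)%N.
    by apply: leq_trans (DL s0); have := eetau n s0 Ps0; rewrite /D; lia.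
  have cardB := card_form_vanish x as0 jd tauL.
  have htauN : (1 < #|F| ^ tau)%N by rewrite -(ltr_nat R) natrX.
  have [y yB ypot] := exists_good_splice x (DD n) DL htauN cardB.
  exists (splice (D n) x y) => _; split; first by move=> s k; exact: splice_lt.
  (* A [q] violating the new level would make the form vanish on all [tau] digits, putting [y] in
     the excluded set. *)
  - move=> q q0 qK; apply: contrapT => nq.
    move: yB; rewrite inE => /negP; apply; apply/forallP => r; apply/eqP.
    apply: (ann (splice (D n) x y) q) => //.
    + by move=> s k kD; rewrite splice_lt.
    + by move: qK; rewrite mulSn addnC.
    + move=> s j Ps je; apply/eqP; apply: contrapT => /negP nz.
      by apply: nq; exists s, j.
  - apply: (le_trans ypot); apply: lee_wpmul2r; first exact: potential_ge0.
    by rewrite lee_fin natrX.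
have [next nextP] := choice step.
pose xs := fix xs n := if n is n'.+1 then next (n', xs n') else fun=> fun=> 0 : F.
have xsK n : inj_level P (e n) (n * T) (xs n).
  elim: n => [q q0|n IH]; last by have [] := nextP (n, xs n) IH.
  by rewrite mul0n leqn0 size_poly_eq0 (negPf q0).
have xsS n s k : (k < D n s)%N -> xs n.+1 s k = xs n s k.
  by have [+ _ _] := nextP (n, xs n) (xsK n); apply.
have xsm n n' s k : (n <= n')%N -> (k < D n s)%N -> xs n' s k = xs n s k.
  move=> /subnKC <-; elim: (n' - n)%N => [|d IH] kD; first by rewrite addn0.
  rewrite addnS xsS ?IH//; apply: leq_trans kD _.
  by elim: d {IH} => [|d IH]; rewrite ?addn0// addnS (leq_trans IH).
(* Stage [k.+1] already fixes digit [k], since [n <= D n s]. *)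
pose x s k := xs k.+1 s k.
have nD n s : (n <= D n s)%N by rewrite /D; nia.
have xE n s k : (k < D n s)%N -> x s k = xs n s k.
  move=> kD; rewrite /x; have [kn|nk] := leqP k.+1 n.
    by rewrite -(xsm _ _ _ _ kn)//; exact: nD.
  by rewrite (xsm n) // ltnW.
have pot0 : (potential (D 0%N) (xs 0%N) < 1)%E.
  apply: le_lt_trans (potential_le _ _) _.
  rewrite -lte_pdivlMl; last by rewrite exprn_gt0// natr_card_gt0.
  by rewrite mule1.
have potn n : (potential (D n) (xs n) <= (lambda ^+ n)%:E * potential (D 0%N) (xs 0%N))%E.
  elim: n => [|n IH]; first by rewrite expr0 mul1e.
  have [_ _] := nextP (n, xs n) (xsK n); move=> /= /le_trans; apply.
  by rewrite exprS EFinM -muleA lee_wpmul2l// lee_fin.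
exists x => [n q q0 qn|j xu].
  have [s [j [Ps je nz]]] := xsK n q q0 qn; exists s, j; split => //.
  rewrite (eq_frac_coef (y := xs n s))// => k /andP[_ kj]; apply: xE.
  by rewrite /D; lia.
have lampos : 0 < lambda.
  by apply: lt_le_trans lam; rewrite invr_gt0 subr_gt0 invf_lt1 ?(lt_trans ltr01).
rewrite -lte_fin.
have -> : h ^+ (N * m j) = density (m j) (u j) (D (m j)) (xs (m j)).
  rewrite density_full// => s k km; rewrite -xu// -xE//; exact: leq_trans (nD _ _).
apply: le_lt_trans (potential_ge_term _ _ _) _.
apply: le_lt_trans (potn _) _.
rewrite -[ltRHS]mule1 lte_pmul2l// lte_fin exprn_gt0//.
Qed.
End Potential.

(** * From digits to badly approximable points *)

Lemma expr_eventually_lt (R : realType) (z e : R) : 0 <= z < 1 -> 0 < e ->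
  exists n, forall n', (n <= n')%N -> z ^+ n' < e.
Proof.
move=> /andP[z0 z1] e0; have zn : `|z| < 1 by rewrite ger0_norm.
have /cvgr0Pnorm_lt/(_ e e0)[n _ nP] := cvg_expr zn.
by exists n => n' nn'; rewrite -[ltLHS]ger0_norm ?exprn_ge0//; exact: nP.
Qed.

(** * Rounded weights *)

Section Exponents.
Variables (R : realType) (N : nat) (i : 'I_N -> R).
Hypothesis hi : forall s, 0 <= i s.

Definition rounded_exponent (T C n : nat) (s : 'I_N) : nat :=
  Num.truncn ((n * T + C)%:R * i s).

Lemma rounded_exponent_le T C n s :
  (rounded_exponent T C n s)%:R <= (n * T + C)%:R * i s.
Proof. by rewrite truncn_le mulr_ge0. Qed.

Lemma rounded_exponent_mono T C n s :
  (rounded_exponent T C n s <= rounded_exponent T C n.+1 s)%N.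
Proof. by apply: le_truncn; rewrite ler_wpM2r// ler_nat; lia. Qed.

Lemma rounded_exponent_step T C tau n s : tau%:R <= T%:R * i s ->
  (rounded_exponent T C n s + tau <= rounded_exponent T C n.+1 s)%N.
Proof.
move=> tauT; rewrite truncn_ge_nat ?mulr_ge0// natrD.
apply: le_trans (lerD (rounded_exponent_le T C n s) tauT) _.
by rewrite -mulrDl -natrD ler_wpM2r// ler_nat; lia.
Qed.

(** Rounding down loses at most [N] in total and subtracting [T] at most [N * T]; [C] absorbs both
    and the extra [T]. *)
Lemma rounded_exponent_sum T C n : \sum_(s < N) i s = 1 -> (N + N * T + T < C)%N ->
  (n * T + T < \sum_(s | i s != 0%R) (rounded_exponent T C n s - T))%N.
Proof.
move=> hsum CN; set e := rounded_exponent T C n.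
have sumE : (n * T + C <= \sum_(s | i s != 0%R) e s + N)%N.
  rewrite -(ler_nat R) [leRHS]natrD natr_sum.
  have -> : (n * T + C)%:R = \sum_(s | i s != 0%R) (n * T + C)%:R * i s.
    rewrite -big_distrr /= -[LHS]mulr1 -hsum; congr (_ * _).
    rewrite [LHS](bigID (fun s => i s != 0%R)) /= [X in _ + X]big1 ?addr0// => s.
    by rewrite negbK => /eqP.
  have Nge : \sum_(s | i s != 0%R) (1 : R) <= N%:R.
    by rewrite sumr_const ler_nat -[leqRHS]card_ord max_card.
  apply: le_trans (lerD (lexx _) Nge); rewrite -big_split; apply: ler_sum => s _.
  by rewrite /= natr1; apply/ltW/truncnS_gt.
have subE : (\sum_(s | i s != 0%R) e s <= \sum_(s | i s != 0%R) (e s - T) + N * T)%N.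
  have NT : (\sum_(s | i s != 0%R) T <= N * T)%N.
    by rewrite sum_nat_const leq_mul2r -[X in (_ <= X)%N]card_ord max_card orbT.
  apply: leq_trans (leq_add (leqnn _) NT); rewrite -big_split leq_sum// => s _.
  by rewrite /=; lia.
by move: sumE subE CN; lia.
Qed.

Lemma exists_step (tau : nat) : (0 < tau)%N -> exists2 T, (0 < T)%N &
  forall s, i s != 0 -> tau%:R <= T%:R * i s.
Proof.
move=> tau0; exists (\max_s (Num.truncn (tau%:R / i s)).+1).+1 => // s is0.
have i0 : 0 < i s by rewrite lt_def is0 hi.
rewrite -ler_pdivrMr//; apply/ltW/(lt_le_trans (truncnS_gt _)).
rewrite ler_nat; apply: leqW.
exact: (leq_bigmax (F := fun s => (Num.truncn (tau%:R / i s)).+1)).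
Qed.

End Exponents.

(** * Norms of Laurent series and the criterion for [Bad] *)

Section Norm.
Variables (R : realType) (F : finFieldType).
Implicit Types (f : int -> F) (q : {poly F}).
Local Notation h := (#|F|%:R : R).
Local Notation lnorm := (@lnorm R F).

(** The vanishing above [n] bounds the set of powers; otherwise [sup] could take its default
    value. *)
Lemma lnorm_ge f (n k : int) : (forall l : int, n < l -> f l = 0) -> f k != 0 ->
  h ^ k <= lnorm f.
Proof.
move=> fn fk; apply: ub_le_sup; last by exists k.
exists (h ^ n) => _ [l /= fl <-]; rewrite ler_eXz2l ?natr_card_gt1// leNgt.
by apply: contra fl => /fn ->.
Qed.

Lemma lnorm_le f (B : R) : 0 <= B -> (forall k, f k != 0 -> h ^ k <= B) ->
  lnorm f <= B.
Proof.
move=> B0 fB; rewrite /Defs.lnorm; set E := [set _ | _ in _].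
have [->|/set0P E0] := eqVneq E set0; first by rewrite sup0.
by apply: ge_sup => // _ [k /fB ? <-].
Qed.

(** [Negz n] is -(n+1), so [z n] is the coefficient of X^-(n+1). *)
Definition fractional (z : nat -> F) (k : int) : F :=
  if k is Negz n then z n else 0.

Lemma fractional_is_laurent z : is_laurent (fractional z).
Proof. by exists 0 => -[]. Qed.

Definition frac_laurent z : laurent F := exist _ _ (fractional_is_laurent z).

Lemma pmul_coef_fractional q z j :
  pmul_coef q (fractional z) (Negz j) = frac_coef q z j.
Proof.
apply: eq_bigr => l _; congr (_ * _).
by have -> : Negz j - (l : nat)%:Z = Negz (j + l) by lia.
Qed.

(** A polynomial [p] cannot cancel a coefficient of q z at a negative power. *)
Lemma approx_err_ge q p z j : frac_coef q z j != 0 ->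
  h ^ (Negz j) <= approx_err R q p (frac_laurent z).
Proof.
move=> qz; apply: (@lnorm_ge _ (size q + size p)%:Z) => [l ql|]; last first.
  by rewrite pmul_coef_fractional subr0.
rewrite /pmul_coef /= big1 => [|m _]; last first.
  have mq : (m < size q)%N by []; suff -> : fractional z (l - (m : nat)%:Z) = 0 by rewrite mulr0.
  have : 0 <= l - (m : nat)%:Z by move: ql mq; set a := size q; lia.
  by case: (l - _).
case: l ql => // l; rewrite ltz_nat => ql; rewrite /= nth_default ?subr0//.
exact: leq_trans (leq_addl _ _) (ltnW ql).
Qed.

Lemma pnorm_ge q : q != 0 -> h ^+ (size q).-1 <= pnorm R q.
Proof.
move=> q0; apply: (@lnorm_ge _ (size q)%:Z) (size q).-1 _ _ => [[]//= l ql|].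
  by rewrite nth_default//; lia.
by rewrite /= -lead_coefE lead_coef_eq0.
Qed.

Lemma Bad_of_inj_level N (i : 'I_N -> R) T C (x : 'I_N -> nat -> F) :
  (forall s, 0 <= i s) -> (0 < T)%N ->
  (forall n, inj_level (fun s => i s != 0) (rounded_exponent i T C n) (n * T) x) ->
  Bad i (frac_laurent \o x).
Proof.
move=> hi T0 xK; have h0 : 0 < h := natr_card_gt0 R F.
(* The stage used for [q] of degree [d] is the first [n] with d < n T; then n T + C <= d + T + C,
   and the constant absorbs T + C. *)
exists (h ^- (T + C)); first by rewrite invr_gt0 exprn_gt0.
move=> q p q0; set d := (size q).-1.
have sq : size q = d.+1 by rewrite prednK// size_poly_gt0.
have [s [j [is0 je nz]]] := xK (d %/ T).+1 q q0 (ltac:(rewrite sq ltn_ceil//)).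
have i0 : 0 < i s by rewrite lt_def is0 hi.
apply: le_trans (le_bigmax_cond 0
  (fun s => approx_err R q (p s) ((frac_laurent \o x) s) `^ (i s)^-1) is0).
apply: (@le_trans _ _ (h ^- (d + T + C))).
  have -> : h ^- (d + T + C) = h ^- (T + C) * h ^- d.
    by rewrite -invfM -exprD addnAC -addnA [(C + T)%N]addnC addnC.
  rewrite ler_wpM2l ?invr_ge0 ?exprn_ge0 ?(ltW h0)//.
  rewrite lef_pV2 ?posrE ?exprn_gt0//; first exact: pnorm_ge.
  by apply: lt_le_trans (pnorm_ge q0); rewrite exprn_gt0.
apply: (@le_trans _ _ ((h ^ (Negz j)) `^ (i s)^-1)); last first.
  rewrite ge0_ler_powR ?nnegrE ?invr_ge0 ?exprz_ge0 ?(ltW h0) ?(ltW i0)//.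
    by apply: le_trans (approx_err_ge (p s) nz); rewrite exprz_ge0// ltW.
  exact: approx_err_ge.
(* The weight cancels: j + 1 <= e_n(s) <= (d + T + C) i_s, and the power 1/i_s removes [i s]. *)
rewrite -powR_intmul ?(ltW h0)// -powRrM -powR_invn ?(ltW h0)//.
apply: ler_powR; first exact/ltW/natr_card_gt1.
rewrite NegzE mulrNz mulNr lerN2 ler_pdivrMr//.
apply: (@le_trans _ _ (rounded_exponent i T C (d %/ T).+1 s)%:R).
  by rewrite ler_nat.
apply: le_trans (rounded_exponent_le hi _ _ _ _) _.
rewrite ler_wpM2r// ler_nat leq_add2r mulSn addnC leq_add2r leq_divM//.
Qed.

End Norm.

(** * Lower bound *)

Section HausdorffMeasure.
Variables (R : realType) (T : Type) (d : T -> T -> R).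
Hypothesis d0 : forall x y, 0 <= d x y.
Implicit Types (U A : set T).

Lemma cover_term_ge0 s U : 0 <= cover_term d s U.
Proof. by rewrite /cover_term; case: (pselect _) => [?|?] //=; exact: powR_ge0. Qed.

Lemma diam_fin_num U x delta : (diam d U <= delta%:E)%E -> U x ->
  diam d U \is a fin_num.
Proof.
move=> Ud Ux; rewrite ge0_fin_numE; first by apply: le_lt_trans Ud _; rewrite ltry.
apply: (@le_trans _ _ (d x x)%:E); first by rewrite lee_fin.
by apply: ereal_sup_ubound; exists x => //; exists x.
Qed.

Lemma dist_le_diam U x y delta : (diam d U <= delta%:E)%E -> U x -> U y ->
  d x y <= fine (diam d U).
Proof.
move=> Ud Ux Uy; rewrite -lee_fin fineK ?(diam_fin_num Ud Ux)//.
by apply: ereal_sup_ubound; exists x => //; exists y.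
Qed.

Lemma fine_diam_bounds U x delta : (diam d U <= delta%:E)%E -> U x ->
  0 <= fine (diam d U) <= delta.
Proof.
move=> Ud Ux; rewrite (le_trans (d0 x x) (dist_le_diam Ud Ux Ux))/=.
by rewrite -lee_fin fineK ?(diam_fin_num Ud Ux).
Qed.

Lemma hausdorff_content_ge0 s delta A : (0 <= hausdorff_content d s delta A)%E.
Proof.
apply: le_ereal_inf_tmp => _ [U _ <-]; apply: nneseries_ge0 => n _ _.
by rewrite lee_fin cover_term_ge0.
Qed.

Lemma hausdorff_content_le_measure s delta A : 0 < delta ->
  (hausdorff_content d s delta A <= hausdorff_measure d s A)%E.
Proof. by move=> delta0; apply: ereal_sup_ubound; exists delta. Qed.

Lemma hausdorff_measure_eq0 s A :
  (forall delta e : R, 0 < delta -> 0 < e -> (hausdorff_content d s delta A <= e%:E)%E) ->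
  hausdorff_measure d s A = 0%E.
Proof.
move=> small; apply/eqP; rewrite eq_le; apply/andP; split; last first.
  apply: le_trans (hausdorff_content_le_measure s A ltr01).
  exact: hausdorff_content_ge0.
apply: ge_ereal_sup => _ [delta /= delta0 <-].
by apply/lee_addgt0Pr => e e0; rewrite add0e; exact: small.
Qed.

(** A bijection of [nat] with its square makes the double family one cover; the terms are
    nonnegative, so the order of summation is irrelevant. *)
Lemma hausdorff_content_double s delta A (U : nat -> nat -> set T) :
  A `<=` \bigcup_i \bigcup_j U i j ->
  (forall i j, (diam d (U i j) <= delta%:E)%E) ->
  (hausdorff_content d s delta A <=
   \sum_(0 <= i <oo) \sum_(0 <= j <oo) (cover_term d s (U i j))%:E)%E.
Proof.
move=> AU Ud; pose t (p : nat * nat) := (cover_term d s (U p.1 p.2))%:E.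
have t0 p : (0 <= t p)%E by rewrite lee_fin cover_term_ge0.
have -> : (\sum_(0 <= i <oo) \sum_(0 <= j <oo) (cover_term d s (U i j))%:E =
    \esum_(p in [set: nat * nat]) t p)%E.
  rewrite nneseries_esumT; last by move=> i; apply: nneseries_ge0 => j _ _; exact: (t0 (i, j)).
  under eq_esum => i _ do rewrite (nneseries_esumT (fun j => t0 (i, j))).
  rewrite esum_esum; last by move=> i j _ _; exact: (t0 (i, j)).
  by congr esum; apply/seteqP; split.
have /card_esym/ppcard_eqP[f] := card_nat2.
rewrite (reindex_esum [set: nat] [set: nat * nat] f); last exact: bij.
rewrite -nneseries_esumT => [|n]; last exact: t0.
apply: ereal_inf_lbound; exists (fun n => U (f n).1 (f n).2) => //; split => //.
move=> x /AU[i _ [j _ xU]]; exists (f^-1%FUN (i, j)) => //=.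
by rewrite invK ?inE.
Qed.

End HausdorffMeasure.

(** * Escaping a cover inside [Bad] *)

Section LaurentDist.
Variables (R : realType) (F : finFieldType) (N : nat).
Local Notation h := (#|F|%:R : R).
Implicit Types (x y : 'I_N -> laurent F).
Local Notation dist := (@laurent_dist R F N).

Lemma laurent_dist_ge0 x y : 0 <= dist x y.
Proof. exact: bigmax_ge_id. Qed.

Lemma laurent_dist_le x y (B : R) : 0 <= B ->
  (forall s k, sval (x s) k != sval (y s) k -> h ^ k <= B) -> dist x y <= B.
Proof.
move=> B0 xyB; apply: bigmax_le => // s _; apply: lnorm_le => // k.
by rewrite subr_eq0; exact: xyB.
Qed.

Lemma frac_laurent_dist_ge (x y : 'I_N -> nat -> F) s k : x s k != y s k ->
  h ^- k.+1 <= dist (@frac_laurent F \o x) (@frac_laurent F \o y).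
Proof.
move=> xy; apply: le_trans (le_bigmax 0 _ s).
apply: (@lnorm_ge _ _ _ 0 (Negz k)) => [[] // l _|]; last by rewrite /= subr_eq0.
by rewrite /= subr0.
Qed.

(** For positive [s] and [dd], [m] is the largest with dd < h^-m, and rounding to a power of h costs
    the factor h^s. [eta] serves dd = 0, where no largest [m] exists. *)
Lemma exists_scale (s dd eta : R) : 0 <= s -> 0 <= dd < 1 -> 0 < eta ->
  exists m : nat, dd < h ^- m /\ h `^ (- (s * m%:R)) <= h `^ s * dd `^ s + eta.
Proof.
move=> s0 /andP[d0 d1] eta0; have h0 := natr_card_gt0 R F; have h1 := natr_card_gt1 R F.
have [->|sn0] := eqVneq s 0.
  by exists 0%N; rewrite expr0 invr1 mul0r oppr0 !powRr0 mulr1 lerDl ltW.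
have sp : 0 < s by rewrite lt_def sn0.
have [->|dn0] := eqVneq dd 0.
  have z1 : 0 <= h `^ (- s) < 1.
    rewrite powR_ge0 /= powRN invf_lt1 ?powR_gt0//.
    by have := gt0_ltr_powR sp _ _ h1; rewrite powR1; apply; rewrite nnegrE// ltW.
  have [m /(_ m (leqnn m)) mP] := expr_eventually_lt z1 eta0.
  exists m; split; first by rewrite invr_gt0 exprn_gt0.
  rewrite powR0// mulr0 add0r -mulNr powRrM powR_mulrn ?powR_ge0//; exact: ltW.
have dp : 0 < dd by rewrite lt_def dn0.
have hm (m : nat) : h ^- m = h^-1 ^+ m by rewrite exprVn.
have z1 : 0 <= h^-1 < 1 by rewrite invr_ge0 ltW//= invf_lt1.
have ex : exists m, h ^- m <= dd.
  by have [m /(_ m (leqnn m)) mP] := expr_eventually_lt z1 dp; exists m; rewrite hm ltW.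
case: (ex_minnP ex) => -[|m] mP mmin.
  by move: mP; rewrite expr0 invr1 leNgt d1.
exists m; split; first by rewrite ltNge; apply/negP => /mmin; rewrite ltnn.
rewrite (@le_trans _ _ (h `^ s * dd `^ s)) ?lerDl ?(ltW eta0)//.
rewrite -powRM ?(ltW h0)//.
have -> : - (s * m%:R) = - m%:R * s by rewrite mulNr mulrC.
rewrite powRrM powR_invn ?(ltW h0)//.
apply: ge0_ler_powR => //; rewrite ?nnegrE ?invr_ge0 ?exprn_ge0 ?mulr_ge0 ?(ltW h0)//.
by rewrite -ler_pdivrMl// -invfM -exprS.
Qed.

(** (1 - h^-tau)^-1 tends to 1, while h^(N - s) > 1 because s < N. *)
Lemma exists_contraction (s : R) : s < N%:R -> exists2 tau, (0 < tau)%N &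
  (1 - (h ^+ tau)^-1)^-1 <= h `^ (N%:R - s).
Proof.
move=> sN; have h0 := natr_card_gt0 R F; have h1 := natr_card_gt1 R F.
set lambda := h `^ _; have l1 : 1 < lambda.
  have Ns : 0 < N%:R - s by rewrite subr_gt0.
  by have := gt0_ltr_powR Ns _ _ h1; rewrite powR1; apply; rewrite nnegrE// ltW.
have l0 := lt_trans ltr01 l1.
have z1 : 0 <= h^-1 < 1 by rewrite invr_ge0 ltW//= invf_lt1.
have e0 : 0 < 1 - lambda^-1 by rewrite subr_gt0 invf_lt1.
have [n /(_ n.+1 (leqnSn n)) nP] := expr_eventually_lt z1 e0.
exists n.+1 => //; rewrite -[leRHS]invrK lef_pV2 ?posrE ?invr_gt0//.
  by rewrite -exprVn lerBrDl -lerBrDr ltW.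
by rewrite subr_gt0 invf_lt1 ?exprn_gt0// exprn_egt1.
Qed.

Lemma hausdorff_measure_Bad_neq0 (i : 'I_N -> R) (s : R) :
  (forall t, 0 <= i t) -> \sum_(t < N) i t = 1 -> 0 <= s < N%:R ->
  hausdorff_measure dist s (@Bad R F N i) <> 0%E.
Proof.
move=> hi hsum /andP[s0 sN] Hs0; have h0 := natr_card_gt0 R F; have h1 := natr_card_gt1 R F.
have [tau tau0 lam] := exists_contraction sN.
have [T T0 Ttau] := exists_step hi tau0.
pose C := (N + N * T + T).+1; pose e := rounded_exponent i T C.
pose kappa : R := h ^- (\sum_t e 0%N t).
have kappa0 : 0 < kappa by rewrite invr_gt0 exprn_gt0.
(* The diameters then contribute at most kappa/4 to the sum of the [b j], and the errors
   kappa/4/2^(j+1) another kappa/4. *)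
pose eps := kappa / 4 / h `^ s.
have eps0 : 0 < eps by rewrite !divr_gt0// powR_gt0.
(* Diameters at most 1/2 keep [dd j] below 1 for [exists_scale]. *)
have half0 : 0 < 2^-1 :> R by rewrite invr_gt0.
have : (hausdorff_content dist s 2^-1 (@Bad R F N i) < eps%:E)%E.
  by apply: le_lt_trans (hausdorff_content_le_measure _ _ _ half0) _; rewrite Hs0.
move=> /ereal_inf_lt[_ [U [BadU Udiam] <-] Usum].
pose dd j := fine (diam dist (U j)).
have small j : exists m, U j !=set0 -> dd j < h ^- m /\
    h `^ (- (s * m%:R)) <= h `^ s * dd j `^ s + kappa / 4 / (2 ^ j.+1)%:R.
  have [[x Ux]|nU] := pselect (U j !=set0); last by exists 0%N.
  have /andP[d0 dhalf] := fine_diam_bounds laurent_dist_ge0 (Udiam j) Ux.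
  have [||m mP] := @exists_scale s (dd j) (kappa / 4 / (2 ^ j.+1)%:R) s0 _ _.
  - by rewrite d0 (le_lt_trans dhalf)// invf_lt1// ltr1n.
  - by rewrite !divr_gt0// ltr0n expn_gt0.
  - by exists m.
have [m mP] := choice small.
(* The constructed point is fractional, so the centre matters only if [U j] contains a fractional
   point. *)
have center j : exists u : 'I_N -> nat -> F,
    forall x : 'I_N -> nat -> F, U j (@frac_laurent F \o x) -> U j (@frac_laurent F \o u).
  have [[x Ux]|nU] := pselect (exists x : 'I_N -> nat -> F, U j (@frac_laurent F \o x)).
    by exists x.
  by exists (fun=> fun=> 0) => x Ux; case: nU; exists x.
have [u uP] := choice center.
pose b j : R := if pselect (U j = set0) then 0 else h `^ (- (s * (m j)%:R)).
have b0 j : 0 <= b j by rewrite /b; case: (pselect _) => [?|?] //=; exact: powR_ge0.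
have bsum : (\sum_(0 <= j <oo) (b j)%:E < kappa%:E)%E.
  apply: (@le_lt_trans _ _ (\sum_(0 <= j <oo) ((h `^ s * cover_term dist s (U j))%:E +
      (kappa / 4 / (2 ^ j.+1)%:R)%:E))%E).
    apply: lee_nneseries => j _; first by rewrite lee_fin.
    rewrite -EFinD lee_fin /b /cover_term.
    case: (pselect _) => [?|/eqP/set0P Uj] /=; last by have [] := mP j Uj.
    by rewrite mulr0 add0r !divr_ge0// ltW.
  apply: le_lt_trans (epsilon_trick _ _ _) _.
  - by move=> j; rewrite lee_fin mulr_ge0 ?powR_ge0// cover_term_ge0.
  - by rewrite divr_ge0// ltW.
  under eq_eseriesr do rewrite EFinM.
  rewrite nneseriesZl; last by move=> j _; rewrite lee_fin cover_term_ge0.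
  apply: (@le_lt_trans _ _ ((kappa / 4)%:E + (kappa / 4)%:E)%E).
    rewrite leeD2r// -lee_pdivlMl ?powR_gt0//.
    by apply: le_trans (ltW Usum) _; rewrite -EFinM lee_fin /eps mulrC.
  by rewrite -EFinD lte_fin; lra.
have [x xK xU] := @avoiding_bad_digits R F N b m u b0 (fun t => i t != 0) e T tau
  (h `^ (N%:R - s)) T0 tau0 (fun n t => rounded_exponent_mono hi T C n t)
  (fun n t it0 => rounded_exponent_step hi C n (Ttau t it0))
  (fun n => rounded_exponent_sum n hsum (ltnSn _)) lam bsum.
have [j _ Ujx] := BadU _ (Bad_of_inj_level hi T0 xK).
have Uj0 : U j !=set0 by exists (@frac_laurent F \o x).
have xuj t k : (k < m j)%N -> x t k = u j t k.
  move=> km; apply/eqP; apply: contrapT => /negP xut.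
  have := le_trans (frac_laurent_dist_ge xut)
    (dist_le_diam laurent_dist_ge0 (Udiam j) Ujx (uP j _ Ujx)).
  move=> /le_lt_trans/(_ (mP j Uj0).1); rewrite ltNge => /negP; apply.
  rewrite lef_pV2 ?posrE ?exprn_gt0// ler_eXn2l//.
(* Contradiction: both sides of the strict inequality are h^((N - s) m_j). *)
have := xU j xuj; rewrite /b; case: (pselect _) => [U0|_] /=.
  by case: Uj0 => y; rewrite U0.
rewrite -!powR_mulrn ?powR_ge0 ?(ltW h0)// -powRrM -powRD; last first.
  by rewrite (gt_eqF h0) implybT.
suff -> : - (s * (m j)%:R) + (N * m j)%:R = (N%:R - s) * (m j)%:R by rewrite ltxx.
by rewrite natrM; ring.
Qed.
End LaurentDist.

(** * Upper bound *)

Section UpperBound.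
Variables (R : realType) (F : finFieldType) (N : nat).
Local Notation h := (#|F|%:R : R).
Local Notation dist := (@laurent_dist R F N).

(** Coefficients from X^-n upwards are prescribed, being 0 from X^(L-n) on; the lower ones are
    free. *)
Definition box L (n : nat) (w : {ffun 'I_N * 'I_L -> F}) : set ('I_N -> laurent F) :=
  [set x | forall s (k : nat), sval (x s) (k%:Z - n%:Z) =
                               oapp (fun o => w (s, o)) 0 (insub k)].

Lemma diam_box_le L n (w : {ffun 'I_N * 'I_L -> F}) :
  (diam dist (box n w) <= (h ^- n)%:E)%E.
Proof.
apply: ge_ereal_sup => _ [x xw [y yw <-]]; rewrite lee_fin.
apply: laurent_dist_le => [|s k xy]; first by rewrite invr_ge0 exprn_ge0.
have kn : k <= - n%:Z.
  rewrite leNgt; apply: contra xy => nk; apply/eqP.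
  have -> : k = `|(k + n%:Z)%R|%N%:Z - n%:Z by lia.
  by rewrite xw yw.
have -> : h ^- n = h ^ (- n%:Z) by rewrite -exprnN.
by rewrite ler_eXz2l ?natr_card_gt1.
Qed.

(** [M] only has to exceed the degrees of the coordinates, so [n] can later be chosen depending on
    [M]. *)
Lemma box_cover (x : 'I_N -> laurent F) :
  exists M, forall n, exists w : {ffun 'I_N * 'I_(M + n) -> F}, box n w x.
Proof.
have [b bP] := choice (fun s => svalP (x s)).
exists (\max_s `|b s|%N).+1 => n.
exists [ffun p : 'I_N * 'I_(_ + n) => sval (x p.1) (p.2%:Z - n%:Z)] => s k.
case: insubP => [l _ lk|kM] /=; first by rewrite ffunE /= lk.
apply: bP; have := leq_bigmax (F := fun s => `|b s|%N) s; move: kM.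
set M := (\max_s `|b s|)%N; lia.
Qed.

Lemma cover_term_box_le s L n (w : {ffun 'I_N * 'I_L -> F}) : 0 <= s ->
  cover_term dist s (box n w) <= (h ^- n) `^ s.
Proof.
move=> s0; rewrite /cover_term; case: (pselect _) => [_|/eqP/set0P[x xw]] /=.
  exact: powR_ge0.
have /andP[d0 dn] := fine_diam_bounds (@laurent_dist_ge0 R F N) (diam_box_le n w) xw.
by apply: ge0_ler_powR => //; rewrite nnegrE invr_ge0 exprn_ge0.
Qed.

Lemma hausdorff_measure_gt_dim s (A : set ('I_N -> laurent F)) : N%:R < s ->
  hausdorff_measure dist s A = 0%E.
Proof.
move=> Ns; have s0 : 0 <= s by apply: le_trans (ltW Ns).
have h0 := natr_card_gt0 R F; have h1 := natr_card_gt1 R F.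
apply: hausdorff_measure_eq0 => delta eps delta0 eps0.
(* For fixed [M] the boxes cost h^(N M) h^((N - s) n) in total, which tends to 0 as [n] grows. *)
have fine_scale M : exists n, h ^- n <= delta /\
    h ^+ (N * (M + n)) * (h ^- n) `^ s <= eps / (2 ^ M.+1)%:R.
  have z1 : 0 <= h^-1 < 1 by rewrite invr_ge0 ltW//= invf_lt1.
  have [n1 n1P] := expr_eventually_lt z1 delta0.
  have z2 : 0 <= h `^ (N%:R - s) < 1.
    rewrite powR_ge0 /= -opprB powRN invf_lt1 ?powR_gt0//.
    have sN : 0 < s - N%:R by rewrite subr_gt0.
    by have := gt0_ltr_powR sN _ _ h1; rewrite powR1; apply; rewrite nnegrE// ltW.
  have e0 : 0 < eps / (2 ^ M.+1)%:R / h ^+ (N * M).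
    by rewrite !divr_gt0// ?exprn_gt0// ltr0n expn_gt0.
  have [n2 n2P] := expr_eventually_lt z2 e0.
  exists (maxn n1 n2); set n := maxn n1 n2; split.
    by rewrite -exprVn ltW// n1P// leq_maxl.
  have := n2P n (leq_maxr _ _); rewrite ltr_pdivlMr ?exprn_gt0// => /ltW.
  apply: le_trans; rewrite mulnDr exprD -mulrA [leRHS]mulrC ler_wpM2l ?exprn_ge0//.
  rewrite -powR_invn ?(ltW h0)// -powRrM -!powR_mulrn ?powR_ge0 ?(ltW h0)//.
  rewrite -powRrM -powRD ?(gt_eqF h0) ?implybT// natrM.
  by have -> : N%:R * n%:R + - n%:R * s = (N%:R - s) * n%:R by ring.
have [n nP] := choice fine_scale.
pose G M : finType := {ffun 'I_N * 'I_(M + n M) -> F}.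
(* The finite family of boxes is padded with empty sets, of cost 0 and diameter -oo. *)
pose U M j := oapp (fun o : 'I_#|G M| => box (n M) (enum_val o)) set0 (insub j).
have cU M : (\sum_(0 <= j <oo) (cover_term dist s (U M j))%:E <=
    (eps / (2 ^ M.+1)%:R)%:E)%E.
  rewrite (nneseries_split 0 #|G M|) => [|k _]; last by rewrite lee_fin cover_term_ge0.
  rewrite eseries0 => [|j jG _]; last first.
    rewrite /U insubN -?leqNgt// /cover_term.
    by case: (pselect _).
  rewrite adde0 add0n sumEFin lee_fin; apply: le_trans (nP M).2.
  rewrite big_mkord; apply: (@le_trans _ _ (\sum_(j < #|G M|) (h ^- n M) `^ s)).
    by apply: ler_sum => j _; rewrite /U valK; exact: cover_term_box_le.
  by rewrite sumr_const card_ord -[leLHS]mulr_natl card_ffun card_prod !card_ord natrX.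
apply: (@le_trans _ _ (\sum_(0 <= M <oo) \sum_(0 <= j <oo) (cover_term dist s (U M j))%:E)%E).
  apply: hausdorff_content_double => [x _|M j].
    have [M /(_ (n M))[w xw]] := box_cover x.
    exists M => //; exists (enum_rank (w : G M)) => //.
    by rewrite /U valK /= enum_rankK.
  rewrite /U; case: insubP => [l _ _|_] /=.
    by apply: le_trans (diam_box_le _ _) _; rewrite lee_fin; exact: (nP M).1.
  by apply: ge_ereal_sup => _ [x []].
apply: le_trans (epsilon_trick0 xpredT (ltW eps0)).
apply: lee_nneseries => M _; last exact: cU.
by move=> _; apply: nneseries_ge0 => j _ _; rewrite lee_fin cover_term_ge0.
Qed.

End UpperBound.

Theorem theorem11 (R : realType) (F : finFieldType) (N : nat) (i : 'I_N -> R)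
  (hi : forall s, 0 <= i s) (hsum : \sum_(s < N) i s = 1) :
  hausdorff_dim (@laurent_dist R F N) (@Bad R F N i) = (N%:R)%:E.
Proof.
apply/eqP; rewrite eq_le; apply/andP; split.
  apply/lee_addgt0Pr => e e0; apply: ereal_inf_lbound.
  exists (N%:R + e) => //; split; first by rewrite addr_ge0// ltW.
  by apply: hausdorff_measure_gt_dim; rewrite ltrDl.
apply: le_ereal_inf_tmp => _ [s [s0 Hs] <-]; rewrite lee_fin leNgt; apply/negP => sN.
by apply: (hausdorff_measure_Bad_neq0 hi hsum _ Hs); rewrite s0.
Qed.
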